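(* Let $T$ be a tree, let $n = n(T)$ be its order and $r = \mathrm{rad}(T)$ its radius, and let $C(T)$ be its center. Then $$\varepsilon(T) \geq \begin{cases} r(n+r+1), & |C(T)|=1,\\[2mm] \dfrac{2r(n+r)-n}{2}, & |C(T)|=2.\end{cases}$$ Moreover, equality holds if and only if $T$ is a path.
   Context: Graphs are finite and simple; $n(T)$ is the number of vertices of $T$. $d_T(u,v)$ is the number of edges on the $u,v$-path. The eccentricity of a vertex $v$ is $\varepsilon_T(v)=\max_{u\in V(T)} d_T(v,u)$, and the eccentricity of the tree is $\varepsilon(T)=\sum_{v\in V(T)}\varepsilon_T(v)$. The radius $\mathrm{rad}(T)$ is the minimum of $\varepsilon_T(v)$ over $v\in V(T)$, and the center is $C(T)=\{u\in V(T): \varepsilon_T(u)=\mathrm{rad}(T)\}$. The center of a tree consists of either a single vertex or two adjacent vertices. *)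

(* Defs.v *)
From mathcomp Require Import all_boot.

Set Implicit Arguments.
Unset Strict Implicit.
Unset Printing Implicit Defensive.

(* A graph on the finite vertex type T is given by its adjacency relation e. *)
Section Graph.
Variables (T : finType) (e : rel T).

(* [p] lists the vertices after [u]; the path has [size p] edges. *)
Definition simple_path (u v : T) (p : seq T) : bool :=
  [&& path e u p, last u p == v & uniq (u :: p)].

(* [ucycle e [:: x; y]] holds for every edge xy, hence the bound on the size. *)
Definition acyclic : Prop := forall c : seq T, ucycle e c -> size c <= 2.

Definition is_tree : Prop :=
  [/\ symmetric e, irreflexive e, 0 < #|T|,
      forall u v : T, connect e u v & acyclic].

(* Number of edges on a shortest u,v-path, and #|T| if there is none. In a
   tree there is only one u,v-path: see [tree_path_unique] and [tree_graph_dist]. *)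
Definition graph_dist (u v : T) : nat :=
  \big[minn/#|T|]_(k < #|T| | [exists p : k.-tuple T, simple_path u v p]) k.

Definition eccentricity (v : T) : nat := \max_(u : T) graph_dist v u.

Definition total_eccentricity : nat := \sum_(v : T) eccentricity v.

(* The default value #|T| is harmless: no eccentricity exceeds it. *)
Definition radius : nat := \big[minn/#|T|]_(v : T) eccentricity v.

Definition graph_center : {set T} := [set u | eccentricity u == radius].

Definition is_path_graph : Prop :=
  exists2 f : 'I_#|T| -> T, bijective f &
    forall i j, e (f i) (f j) = (i.+1 == j) || (j.+1 == i).

Lemma tree_path_unique u v p q :
  is_tree -> simple_path u v p -> simple_path u v q -> p = q.
Proof.
case=> eS _ _ _ eA; elim: p u q => [|x p IHp] u [|y q] //.
- case/and3P=> _ /eqP /= <- _ /and3P[_ /eqP /= qu /andP[+ _]].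
  by rewrite -[in X in X \notin _]qu mem_last.
- case/and3P=> _ /eqP /= pv /andP[+ _] /and3P[_ /eqP /= uv _].
  by rewrite uv -pv mem_last.
have [<-{y}|xy] := eqVneq x y.
  move=> /and3P[/= /andP[_ pp] lp /andP[_ up]].
  move=> /and3P[/= /andP[_ pq] lq /andP[_ uq]].
  by rewrite (IHp x q) // /simple_path /= ?pp ?lp ?up ?pq ?lq ?uq.
move=> /and3P[pp /eqP lp up] /and3P[pq /eqP lq uq].
have hq : has (mem (x :: p)) (y :: q).
  apply/hasP; exists v; rewrite /= ?inE.
  - by rewrite -lq /= -in_cons mem_last.
  - by rewrite -lp /= -in_cons mem_last.
have [w [q1 [q2 [Eq wp q1p]]]] : exists w q1 q2,
    [/\ y :: q = q1 ++ w :: q2, w \in x :: p & ~~ has (mem (x :: p)) q1].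
  by case: (split_find hq) => w q1 q2 wp q1p; exists w, q1, q2; rewrite cat_rcons.
have [p1 [p2 Ep]] : exists p1 p2, x :: p = p1 ++ w :: p2.
  by case/splitPr: wp => p1 p2; exists p1, p2.
rewrite Ep in pp up q1p; rewrite Eq -cat_rcons in pq uq.
pose c := u :: p1 ++ w :: rev q1.
have /eA : ucycle e c.
  rewrite /ucycle /c; apply/andP; split.
    rewrite /= rcons_cat cat_path /=.
    move: pp; rewrite cat_path /= => /and3P[-> -> _] /=.
    move: pq; rewrite cat_path => /andP[+ _].
    rewrite -(eq_path (e := fun z => e^~ z)); last by move=> a b; rewrite /= eS.
    by rewrite -rev_path last_rcons belast_rcons rev_cons.
  move: up uq q1p; rewrite -cat_rcons /= mem_cat negb_or cat_uniq rcons_uniq.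
  rewrite mem_rcons inE negb_or => /andP[/andP[/andP[uw up1] _]].
  case/and3P=> /andP[wp1 up1'] _ _.
  rewrite mem_cat negb_or cat_uniq rcons_uniq mem_rcons inE negb_or.
  case/andP=> /andP[/andP[_ uq1] _] /and3P[/andP[wq1 uq1'] _ _] q1p.
  rewrite mem_cat inE mem_rev !negb_or up1 uw uq1 /= cat_uniq up1' /=.
  rewrite (negPf wp1) mem_rev wq1 rev_uniq uq1' has_rev /= andbT.
  apply: contra q1p; apply: sub_has => z /= zp.
  by rewrite mem_cat mem_rcons inE (zp : z \in p1) orbT.
rewrite /c /= size_cat /= size_rev addnS !ltnS leqn0 addn_eq0 !size_eq0.
case/andP=> /eqP p10 /eqP q10; move: Ep Eq; rewrite p10 q10.
by case=> xw _ [yw _]; rewrite xw yw eqxx in xy.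
Qed.

Lemma tree_graph_dist u v p : is_tree -> simple_path u v p -> graph_dist u v = size p.
Proof.
move=> eT up; have ltp : size p < #|T|.
  by case/and3P: (up) => _ _ /card_uniqP /= <-; apply: max_card.
rewrite /graph_dist (big_pred1_id _ _ (i := Ordinal ltp)) => [|k] /=.
  exact/minn_idPl/ltnW.
apply/existsP/eqP => [[q uq]|->]; last by exists (in_tuple p).
by apply/val_inj; rewrite /= (tree_path_unique eT up uq) size_tuple.
Qed.

End Graph.

(* Main.v *)
(* A simple path on k vertices forces the eccentricity of its i-th vertex to be
   at least max(i, k-1-i); every other vertex has eccentricity at least r, and
   at least r+1 if it is not central. It remains to find a long path: from a
   center c take a branch of length r with first vertex x. If x is not central,
   a vertex w at distance > r from x lies at distance r from c in a direction
   other than x, giving 2r+1 vertices through c. If x is central, take a branch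
   of length r from x: either its first vertex is not central and the same
   argument applies at x, or it is c and both branches together give 2r
   vertices. Equality in the bound forces the path to span the tree. *)
Require Import Defs.
From mathcomp Require Import all_boot all_order all_algebra.
From mathcomp Require Import zify lra.
Set Implicit Arguments.
Unset Strict Implicit.
Unset Printing Implicit Defensive.
Import Order.TTheory GRing.Theory Num.Theory.
Local Open Scope ring_scope.

(** * Eccentricity sums of path graphs *)

(** The total eccentricity of the path graph on [k] vertices, as confirmed by [path_graph_ecc]. *)
Definition path_eccentricity (k : nat) : nat := \sum_(i < k) maxn i (k.-1 - i).

(** Adding a vertex at both ends raises each of the [k] old eccentricities by 1; each new end
    contributes [k.+1]. *)
Lemma path_eccentricitySS k :
  path_eccentricity k.+2 = (path_eccentricity k + k + k.+1.*2)%N.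
Proof.
rewrite /path_eccentricity big_ord_recl big_ord_recr /=.
rewrite (eq_bigr (fun i : 'I_k => maxn i (k.-1 - i) + 1)%N) => [|i _].
  rewrite big_split /= sum_nat_const card_ord /bump /=; lia.
by rewrite /bump /=; have := ltn_ord i; lia.
Qed.

Lemma path_eccentricity_odd m :
  path_eccentricity m.*2.+1 = (3 * m * m + 2 * m)%N.
Proof.
elim: m => [|m IHm]; first by rewrite /path_eccentricity big_ord1.
by rewrite doubleS path_eccentricitySS IHm; lia.
Qed.

Lemma path_eccentricity_even m :
  (path_eccentricity m.*2 + m = 3 * m * m)%N.
Proof.
elim: m => [|m IHm]; first by rewrite /path_eccentricity big_ord0.
by rewrite doubleS path_eccentricitySS; lia.
Qed.

(** * Distances and eccentricities along simple paths of a tree *)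

Section Tree.
Variables (T : finType) (e : rel T).
Hypothesis treeT : is_tree e.

Local Notation d := (graph_dist e).
Local Notation ecc := (eccentricity e).
Local Notation r := (radius e).

Let symE : symmetric e. Proof. by case: treeT. Qed.

Lemma tree_simple_path u v : exists p, simple_path e u v p.
Proof.
case: treeT => _ _ _ /(_ u v) /connectP [p ep ->] _.
by case/shortenP: ep => q eq uq _; exists q; rewrite /simple_path eq eqxx uq.
Qed.

Lemma simple_path_neq u v x p : simple_path e u v (x :: p) -> x != u.
Proof.
case/and3P=> _ _ /andP[+ _].
by rewrite inE negb_or eq_sym => /andP[].
Qed.

Lemma tree_graph_dist_sym u v : d u v = d v u.
Proof.
have [p up] := tree_simple_path u v; rewrite (tree_graph_dist treeT up).
case/and3P: up => ep /eqP lp up.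
suff vp : simple_path e v u (rev (belast u p)).
  by rewrite (tree_graph_dist treeT vp) size_rev size_belast.
apply/and3P; split.
- by rewrite -lp rev_path; apply: sub_path ep => a b /=; rewrite symE.
- by case: p {ep up} lp => [|x p] /= lp; rewrite ?rev_cons ?last_rcons ?lp.
- by rewrite -lp -rev_rcons -lastI rev_uniq.
Qed.

Lemma leq_dist_ecc u v : (d u v <= ecc u)%N.
Proof. exact: leq_bigmax. Qed.

Lemma ecc_attained u : exists v, ecc u = d u v.
Proof.
have T0 : (0 < #|T|)%N by apply/card_gt0P; exists u.
by have [v Ev] := bigop.eq_bigmax (d u) T0; exists v.
Qed.

Lemma radius_leq_ecc u : (r <= ecc u)%N.
Proof. by rewrite /radius -minEnat -leEnat; exact: bigmin_le. Qed.

Lemma radius_lt_ecc u : u \notin graph_center e -> (r < ecc u)%N.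
Proof. by rewrite inE ltn_neqAle radius_leq_ecc eq_sym => ->. Qed.

(** A segment of a simple path is again a simple path, hence the only one between its ends. *)
Lemma dist_on_path x0 s i j : sorted e s -> uniq s -> (i <= j)%N ->
  (j < size s)%N -> d (nth x0 s i) (nth x0 s j) = (j - i)%N.
Proof.
move=> es us ij js; have si := leq_ltn_trans ij js.
have Es := drop_nth x0 si.
have ed : path e (nth x0 s i) (drop i.+1 s).
  by have := drop_sorted i es; rewrite Es.
have ud : uniq (nth x0 s i :: drop i.+1 s) by rewrite -Es drop_uniq.
have sz : size (take (j - i) (drop i.+1 s)) = (j - i)%N.
  by rewrite size_take size_drop; case: ltnP => //; lia.
rewrite -[RHS]sz; apply: (tree_graph_dist treeT); apply/and3P; split.
- exact: take_path.
- rewrite (last_nth x0) sz; case Ek: (j - i)%N => [|k] /=.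
    by apply/eqP; congr nth; lia.
  by rewrite nth_take // nth_drop; apply/eqP; congr nth; lia.
- exact: (take_uniq (j - i).+1 ud).
Qed.

Lemma dist_on_pathE x0 s i j : sorted e s -> uniq s -> (i < size s)%N ->
  (j < size s)%N -> d (nth x0 s i) (nth x0 s j) = ((j - i) + (i - j))%N.
Proof.
move=> es us si sj; case: (leqP i j) => ij.
  by rewrite dist_on_path //; lia.
by rewrite tree_graph_dist_sym dist_on_path //; lia.
Qed.

Lemma ecc_on_path x0 s i : sorted e s -> uniq s -> (i < size s)%N ->
  (maxn i ((size s).-1 - i) <= ecc (nth x0 s i))%N.
Proof.
move=> es us si; rewrite geq_max; apply/andP; split.
  by apply: leq_trans (leq_dist_ecc _ (nth x0 s 0)); rewrite dist_on_pathE //; lia.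
apply: leq_trans (leq_dist_ecc _ (nth x0 s (size s).-1)).
by rewrite dist_on_pathE //; lia.
Qed.

(** Applied with [b] equal to [r.+1] when the path contains the only center, and to [r] when there
    are two centers. *)
Lemma total_ecc_path_bound s b : sorted e s -> uniq s ->
  (forall v, v \notin s -> b <= ecc v)%N ->
  (path_eccentricity (size s) + (#|T| - size s) * b <= total_eccentricity e)%N.
Proof.
move=> es us sb; rewrite /total_eccentricity (bigID (mem s)) /= leq_add //.
  rewrite -big_uniq //; case: s es us {sb} => [|x0 s0] es us.
    by rewrite /path_eccentricity big_ord0.
  rewrite (big_nth x0) big_mkord; apply: leq_sum => i _.
  exact: ecc_on_path.
have -> : (#|T| - size s = #|[predC s]|)%N.
  by rewrite -(card_uniqP us) -(cardC (mem s)) addKn; apply: eq_card.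
by rewrite -sum_nat_const; apply: leq_sum => v /sb.
Qed.

(* A common vertex [z] of the two branches would satisfy both
   [d c z = d x z + 1] and [d x z = d c z + 1]. *)
Lemma join_branches c x u w p q :
  simple_path e c u (x :: p) -> simple_path e x w (c :: q) ->
  let s := rev (x :: p) ++ c :: q in sorted e s /\ uniq s.
Proof.
case/and3P=> e1 _ u1 /and3P[e2 _ u2]; split.
  have /andP[_ ecq] : e x c && path e c q by [].
  rewrite sorted_cat_cons -rev_cons rev_sorted ecq.
  by rewrite andbT; apply: sub_path e1 => a b /=; rewrite symE.
have [/= /andP[_ u1'] /andP[_ u2']] := (u1, u2).
rewrite cat_uniq rev_uniq; apply/and3P; split=> //; apply/hasPn => z.
rewrite /= mem_rev => zq; apply/negP => zp.
have zi : (index z (x :: p) < size (x :: p))%N by rewrite index_mem.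
have zj : (index z (c :: q) < size (c :: q))%N by rewrite index_mem.
have N1 : nth c (c :: x :: p) (index z (x :: p)).+1 = z by rewrite -[RHS](nth_index c zp).
have N2 : nth x (x :: c :: q) (index z (c :: q)).+1 = z by rewrite -[RHS](nth_index x zq).
have := @dist_on_path c (c :: x :: p) 0 (index z (x :: p)).+1 e1 u1 isT zi; rewrite N1 /=.
have := @dist_on_path c (c :: x :: p) 1 (index z (x :: p)).+1 e1 u1 isT zi; rewrite N1 /=.
have := @dist_on_path x (x :: c :: q) 0 (index z (c :: q)).+1 e2 u2 isT zj; rewrite N2 /=.
have := @dist_on_path x (x :: c :: q) 1 (index z (c :: q)).+1 e2 u2 isT zj; rewrite N2 /=.
lia.
Qed.

(** * Long paths through the center *)

Lemma long_path_at_center c u x p : c \in graph_center e ->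
  simple_path e c u (x :: p) -> size (x :: p) = r -> x \notin graph_center e ->
  exists s, [/\ sorted e s, uniq s, size s = r.*2.+1 & c \in s].
Proof.
rewrite inE => /eqP cC up szp /radius_lt_ecc; have [w ->] := ecc_attained x.
have [q uq] := tree_simple_path c w => rw.
have szq : (size q <= r)%N.
  by rewrite -cC -(tree_graph_dist treeT uq) leq_dist_ecc.
have [e1 lq u1] := and3P uq.
have ecx : e x c by case/and3P: up => /= /andP[]; rewrite symE.
have xc := simple_path_neq up.
have [xq|xq] := boolP (x \in q).
  (* If the path from [c] to [w] met [x], its tail [q2] would join [x] to [w] in fewer than [r]
     edges, against [rw]. *)
  case/splitPr: xq szq e1 lq u1 {uq} => q1 q2.
  rewrite size_cat cat_path last_cat /= => szq /and3P[_ _ e1] lq.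
  rewrite cat_uniq => /andP[_ /and3P[_ _ u1]].
  have uq : simple_path e x w q2 by apply/and3P.
  by move: rw; rewrite (tree_graph_dist treeT uq); lia.
have uq' : simple_path e x w (c :: q).
  by apply/and3P; split => //=; [rewrite ecx | rewrite inE negb_or xc xq].
have [es us] := join_branches up uq'.
exists (rev (x :: p) ++ c :: q); split => //.
  (* Since [c :: q] has more than [r] entries and [q] at most [r], [size q] is exactly [r]. *)
  by move: rw; rewrite (tree_graph_dist treeT uq') size_cat size_rev szp /=; lia.
by rewrite mem_cat inE eqxx orbT.
Qed.

Lemma unicentral_path : #|graph_center e| = 1%N ->
  exists s, [/\ sorted e s, uniq s, size s = r.*2.+1
              & forall v, v \notin s -> (r < ecc v)%N].
Proof.
move=> /eqP /cards1P [c Ec]; have cC : c \in graph_center e by rewrite Ec set11.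
suff [s [es us sz cs]] : exists s, [/\ sorted e s, uniq s, size s = r.*2.+1 & c \in s].
  exists s; split => // v vs; apply: radius_lt_ecc; rewrite Ec inE.
  by apply: contraNneq vs => ->.
have [u Eu] := ecc_attained c; have [p up] := tree_simple_path c u.
have szp : size p = r.
  by move: cC; rewrite inE Eu (tree_graph_dist treeT up) => /eqP.
(* For radius 0 the center alone is the path. *)
case: p up szp => [|x p] up szp; first by exists [:: c]; rewrite -szp /= inE.
apply: (long_path_at_center cC up szp).
by rewrite Ec inE (simple_path_neq up).
Qed.

(** The size [r.*2.+1] need not be excluded here: [total_ecc_bicentral] shows that it makes the
    bound strict. *)
Lemma bicentral_path : #|graph_center e| = 2%N ->
  exists s, [/\ sorted e s, uniq s & size s = r.*2 \/ size s = r.*2.+1].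
Proof.
move=> C2; have /cards2P [a [b [ab Eab]]] : (#|graph_center e| == 2)%N by rewrite C2.
have branch c : c \in graph_center e -> exists u x p,
    simple_path e c u (x :: p) /\ size (x :: p) = r.
  move=> cC; have [u Eu] := ecc_attained c; have [p up] := tree_simple_path c u.
  have szp : size p = r.
    by move: (cC); rewrite inE Eu (tree_graph_dist treeT up) => /eqP.
  case: p up szp => [_ r0|x p up szp]; last by exists u, x, p.
  (* Radius 0 would place every vertex at distance 0 from [c], yet there are two centers. *)
  have [y yc] : exists y, y != c.
    by have [<-|ac] := eqVneq a c; [exists b; rewrite eq_sym | exists a].
  have [q uq] := tree_simple_path c y; have := leq_dist_ecc c y.
  move: cC; rewrite inE => /eqP ->.
  rewrite (tree_graph_dist treeT uq) -r0 leqn0 size_eq0 => /eqP q0.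
  by move: uq; rewrite q0 /simple_path /= eq_sym (negPf yc).
have aC : a \in graph_center e by rewrite Eab !inE eqxx.
have [u [x [p [up szp]]]] := branch a aC.
have [xC|xC] := boolP (x \in graph_center e); last first.
  by have [s [es us sz _]] := long_path_at_center aC up szp xC; exists s; split=> //; right.
have [w [y [q [uq szq]]]] := branch x xC.
have [yC|yC] := boolP (y \in graph_center e); last first.
  by have [s [es us sz _]] := long_path_at_center xC uq szq yC; exists s; split=> //; right.
have xa : x != a.
  exact: simple_path_neq up.
have yx : y != x.
  exact: simple_path_neq uq.
have ya : y = a.
  move: xC yC yx; rewrite Eab !inE (negPf xa) /= => /eqP ->.
  by case/orP => /eqP -> //; rewrite eqxx.
rewrite ya in uq szq; have [es us] := join_branches up uq.
(* The two branches cross the edge between [a] and [x] in opposite directions, and each contributes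
   [r] vertices. *)
exists (rev (x :: p) ++ a :: q); split => //; left.
by rewrite size_cat size_rev szp szq addnn.
Qed.

(** * Path graphs, their radius and center *)

(** Adjacency means distance 1, and distance along [s] is the difference of positions, so the tree
    has no edges beyond those of [s]. *)
Lemma spanning_path_is_path_graph s : sorted e s -> uniq s -> size s = #|T| ->
  is_path_graph e.
Proof.
move=> es us sz; have [_ _ /card_gt0P [x0 _] _ _] := treeT.
pose f (i : 'I_#|T|) := nth x0 s i.
have fi : injective f.
  move=> i j /eqP; rewrite /f nth_uniq ?sz ?ltn_ord // => /eqP ij; exact: val_inj.
have adjE u v : e u v = (d u v == 1%N).
  have irr : irreflexive e by case: treeT.
  have [p up] := tree_simple_path u v; rewrite (tree_graph_dist treeT up).
  apply/idP/idP => [uv|].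
    have uv' : simple_path e u v [:: v].
      rewrite /simple_path /= uv eqxx inE !andbT /=.
      by apply: contraTneq uv => ->; rewrite irr.
    by rewrite (tree_path_unique treeT up uv').
  by case: p up => [|x [|]] // /and3P[/= /andP[ux _] /eqP <-].
exists f; first by apply: inj_card_bij; rewrite ?card_ord.
move=> i j; rewrite adjE dist_on_pathE ?sz //; lia.
Qed.

Lemma path_graph_spanning_path : is_path_graph e ->
  exists s, [/\ sorted e s, uniq s & size s = #|T|].
Proof.
case=> f fb fE; exists (codom f); split.
- rewrite sorted_map (eq_sorted (e' := relpre val (fun i j => (i.+1 == j) || (j.+1 == i)))) //.
  rewrite -sorted_map val_enum_ord; apply/(sortedP 0) => i.
  by rewrite size_iota => iT; rewrite !nth_iota ?eqxx //; lia.
- by rewrite map_inj_uniq ?enum_uniq //; apply: bij_inj.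
- by rewrite size_codom card_ord.
Qed.

Lemma ecc_spanning_path x0 s i : sorted e s -> uniq s -> size s = #|T| ->
  (i < #|T|)%N -> ecc (nth x0 s i) = maxn i (#|T|.-1 - i).
Proof.
move=> es us sz iT; apply/eqP; rewrite eqn_leq -{2}sz ecc_on_path ?sz // andbT.
apply/bigmax_leqP => v _.
have vs : v \in s.
  have /subset_cardP/(_ (subset_predT _)) -> // : #|s| = #|T|.
  by rewrite (card_uniqP us).
have vi : (index v s < #|T|)%N by rewrite -sz index_mem.
rewrite -(nth_index x0 vs) dist_on_pathE ?sz //; lia.
Qed.

(** For the converse of the equality case: the number of centers gives the parity of [#|T|], and
    with it [#|T|] in terms of [r]. *)
Lemma path_graph_ecc : is_path_graph e ->
  [/\ total_eccentricity e = path_eccentricity #|T|, r = #|T|./2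
    & #|graph_center e| = if odd #|T| then 1%N else 2%N].
Proof.
case/path_graph_spanning_path => s [es us sz].
have [_ _ T0 _ _] := treeT; have /card_gt0P [x0 _] := T0.
have eccE i : (i < #|T|)%N -> ecc (nth x0 s i) = maxn i (#|T|.-1 - i).
  exact: ecc_spanning_path.
have sT : s =i predT.
  by apply/subset_cardP; rewrite ?subset_predT // (card_uniqP us).
have nthP v : exists2 i, (i < #|T|)%N & v = nth x0 s i.
  have vs : v \in s by rewrite sT.
  by exists (index v s); rewrite ?nth_index // -sz index_mem.
have rE : r = #|T|./2.
  apply/eqP; rewrite eqn_leq; apply/andP; split.
    by apply: leq_trans (radius_leq_ecc (nth x0 s #|T|./2)) _; rewrite eccE; lia.
  (* The default value [#|T|] of the minimum also has to be at least [#|T|./2]. *)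
  rewrite /radius; elim/big_ind: _ => [|a b|v _]; first lia.
    by rewrite leq_min => -> ->.
  by have [i iT ->] := nthP v; rewrite eccE //; lia.
have centE i : (i < #|T|)%N ->
    (nth x0 s i \in graph_center e) = (maxn i (#|T|.-1 - i) == #|T|./2).
  by move=> iT; rewrite inE rE eccE.
split=> //.
  rewrite /total_eccentricity -(eq_bigl _ _ sT) -big_uniq // (big_nth x0) big_mkord sz.
  by apply: eq_bigr => i _; rewrite eccE.
case: ifP => nodd.
  suff -> : graph_center e = [set nth x0 s #|T|./2] by rewrite cards1.
  apply/setP => v; have [i iT ->] := nthP v; rewrite centE // inE nth_uniq ?sz //; lia.
suff -> : graph_center e = [set nth x0 s #|T|./2.-1; nth x0 s #|T|./2].
  by rewrite cards2 nth_uniq ?sz //; lia.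
apply/setP => v; have [i iT ->] := nthP v.
by rewrite centE // !inE !nth_uniq ?sz //; lia.
Qed.

(** * The bounds and their equality cases *)

Lemma total_ecc_unicentral : #|graph_center e| = 1%N ->
  (r * (#|T| + r + 1) <= total_eccentricity e)%N /\
  (total_eccentricity e = r * (#|T| + r + 1) <-> is_path_graph e)%N.
Proof.
move=> C1; have [s [es us sz offs]] := unicentral_path C1.
have := total_ecc_path_bound es us offs.
have := uniq_leq_size us (s2 := enum T); rewrite -cardE.
move/(_ (fun v _ => mem_enum T v)); rewrite sz path_eccentricity_odd => /subnKC nE lb.
(* [k] counts the vertices off the path. The left side of [lb] exceeds the claimed bound by exactly
   [k], so equality forces [k = 0]. *)
move: (#|T| - r.*2.+1)%N nE lb => k nE lb.
split; first by rewrite -nE; nia.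
split=> [eqT|/path_graph_ecc [-> rE]].
  by apply: (spanning_path_is_path_graph es us); rewrite sz; rewrite -nE in eqT *; nia.
rewrite C1; case: ifP => // nodd _.
have {k lb}nE : #|T| = r.*2.+1 by lia.
by rewrite nE path_eccentricity_odd; lia.
Qed.

(** Doubled and with [#|T|] moved across, so that neither division nor subtraction occurs in
    [nat]. *)
Lemma total_ecc_bicentral : #|graph_center e| = 2%N ->
  (2 * r * (#|T| + r) <= 2 * total_eccentricity e + #|T|)%N /\
  (2 * total_eccentricity e + #|T| = 2 * r * (#|T| + r) <-> is_path_graph e)%N.
Proof.
move=> C2; have [s [es us sz]] := bicentral_path C2.
have := total_ecc_path_bound es us (fun v _ => radius_leq_ecc v).
have := uniq_leq_size us (s2 := enum T); rewrite -cardE.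
move/(_ (fun v _ => mem_enum T v)) => sT lb.
have path_eq : is_path_graph e ->
    (2 * total_eccentricity e + #|T| = 2 * r * (#|T| + r))%N.
  case/path_graph_ecc => [-> rE]; rewrite C2; case: ifP => // nodd _.
  have nE : #|T| = r.*2 by lia.
  by have := path_eccentricity_even r; rewrite nE; nia.
case: sz => sz; rewrite sz in sT lb; move/subnKC: sT => nE.
  have := path_eccentricity_even r => Sr.
  (* Again the doubled bound is exceeded by exactly [k]. *)
  move: (#|T| - r.*2)%N nE lb => k nE lb.
  split; first by rewrite -nE; nia.
  split=> // eqT; apply: (spanning_path_is_path_graph es us).
  by rewrite sz; rewrite -nE in eqT *; nia.
rewrite path_eccentricity_odd in lb.
(* Here the excess is at least [4 * r + 1 + k], so equality is impossible. *)
move: (#|T| - r.*2.+1)%N nE lb => k nE lb.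
split; first by rewrite -nE; nia.
by split=> // eqT; exfalso; rewrite -nE in eqT; nia.
Qed.

End Tree.

Theorem theorem3p4 (T : finType) (e : rel T) (treeT : is_tree e) :
  let n : rat := #|T|%:R in
  let r : rat := (radius e)%:R in
  let eps : rat := (total_eccentricity e)%:R in
  (#|graph_center e| = 1%N ->
     eps >= r * (n + r + 1) /\
     (eps = r * (n + r + 1) <-> is_path_graph e)) /\
  (#|graph_center e| = 2%N ->
     eps >= (2 * r * (n + r) - n) / 2 /\
     (eps = (2 * r * (n + r) - n) / 2 <-> is_path_graph e)).
Proof.
move=> n r eps; split=> [C1|C2].
  have [lb eqE] := total_ecc_unicentral treeT C1.
  have -> : r * (n + r + 1) = (radius e * (#|T| + radius e + 1))%:R.
    by rewrite natrM !natrD.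
  rewrite ler_nat; split=> //; rewrite -eqE /eps.
  by split=> [/eqP|->] //; rewrite eqr_nat => /eqP.
have [lb eqE] := total_ecc_bicentral treeT C2.
have E1 : 2 * eps + n = (2 * total_eccentricity e + #|T|)%:R.
  by rewrite natrD natrM.
have E2 : 2 * r * (n + r) = (2 * radius e * (#|T| + radius e))%:R.
  by rewrite !natrM natrD.
have : 2 * r * (n + r) <= 2 * eps + n by rewrite E1 E2 ler_nat.
split; first by lra.
rewrite -eqE; split=> [epsE|/(congr1 (fun k => k%:R : rat))].
  by apply/eqP; rewrite -(eqr_nat rat) -E1 -E2; apply/eqP; lra.
by rewrite -E1 -E2; lra.
Qed.
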